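(* Let $F$ be a field, $k\ge1$, and let $d_1,\ldots,d_k\in F$ be nonzero. Let $p_n=d_1x_1^n+\cdots+d_kx_k^n\in F[x_1,\ldots,x_k]$ for $n\ge 1$, let $\Lambda\subset F[x_1,\ldots,x_k]$ be the $F$-subalgebra generated by all the $p_n$, $n\ge 1$, and let $X=\mathrm{diag}(x_1,\ldots,x_k)$. If there is a non-empty subset $I\subseteq\{1,\ldots,k\}$ with $\sum_{i\in I}d_i=0$, then $X$ is not integral over $\Lambda$.
   Context: $X$ is a $k\times k$ diagonal matrix over $F[x_1,\ldots,x_k]$, and $\Lambda$ acts on such matrices by scalar multiplication. $X$ is integral over $\Lambda$ if there are $N\ge 1$ and $c_0,\ldots,c_{N-1}\in\Lambda$ such that $X^N+c_{N-1}X^{N-1}+\cdots+c_1X+c_0\cdot \mathrm{Id}=0$, where $\mathrm{Id}$ is the identity matrix. *)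

(* Defs.v *)
From HB Require Import structures.
From mathcomp Require Import all_boot all_order all_algebra.
From mathcomp.multinomials Require Import mpoly.

Set Implicit Arguments.
Unset Strict Implicit.
Unset Printing Implicit Defensive.

Import GRing.Theory.
Local Open Scope ring_scope.

(* The constructors are the closure conditions of [GRing.subalg_closed],
   stated for Prop-valued predicates: subalgebras are unital, and closure
   under 0 and opposites follows by taking a = -1. *)
Inductive subalg_gen (K : nzRingType) (A : lalgType K) (G : A -> Prop) :
  A -> Prop :=
| SubalgGen u : G u -> subalg_gen G u
| SubalgOne : subalg_gen G 1
| SubalgLin a u v :
    subalg_gen G u -> subalg_gen G v -> subalg_gen G (a *: u + v)
| SubalgMul u v :
    subalg_gen G u -> subalg_gen G v -> subalg_gen G (u * v).

Definition weighted_psum (F : fieldType) (k : nat) (d : 'I_k -> F) (n : nat) :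
  {mpoly F[k]} := \sum_(i < k) d i *: 'X_i ^+ n.

Definition psum_algebra (F : fieldType) (k : nat) (d : 'I_k -> F) :
  {mpoly F[k]} -> Prop :=
  subalg_gen (fun f => exists2 n : nat, (1 <= n)%N & f = weighted_psum d n).

Definition diag_vars (F : fieldType) (k : nat) : 'M[{mpoly F[k]}]_k :=
  diag_mx (\row_(i < k) 'X_i).

(* The library's [integralOver] takes a ring morphism as coefficient map; here
   the coefficients range over a Prop-valued subset L acting by scaling.
   The term of index 0 is c 0 *: 1%:M. *)
Definition mx_integral_over (R : comNzRingType) (k : nat) (L : R -> Prop)
    (X : 'M[R]_k) : Prop :=
  exists (N : nat) (c : 'I_N -> R),
    [/\ (1 <= N)%N, forall i, L (c i) &
        X ^+ N + \sum_(i < N) c i *: X ^+ i = 0].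

(* Main.v *)
Require Import Defs.
From HB Require Import structures.
From mathcomp Require Import all_boot all_order all_algebra.
From mathcomp.multinomials Require Import mpoly.

Import GRing.Theory.
Local Open Scope ring_scope.

(** The idea is to specialise the variables so that the algebra of weighted
    power sums collapses to the constants while some diagonal entry of the
    matrix stays transcendental.  Send x_i to T for i in I and to 0 outside I.
    For n >= 1 the power sum of exponent n goes to the sum of the d_i over I
    times T^n, which is 0; so the whole algebra goes to F
    ([specialize_psum_algebra]).  An integral equation for the matrix holds
    entrywise on the diagonal ([diag_mx_integral_entry]), and at an index in I
    it specialises to a monic equation over F for the indeterminate T, which is
    absurd ([polyX_not_integral]). *)

Lemma diag_mx_exp (R : comNzRingType) (k : nat) (r : 'rV[R]_k) (n : nat)
    (i : 'I_k) : (diag_mx r ^+ n) i i = r 0 i ^+ n.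
Proof.
elim: n => [|n IHn]; first by rewrite !expr0 mxE eqxx.
by rewrite !exprS -IHn -[_ * _]/(diag_mx r *m _) mul_diag_mx mxE.
Qed.

Lemma diag_mx_integral_entry (R : comNzRingType) (k : nat) (r : 'rV[R]_k)
    (N : nat) (c : 'I_N -> R) (i : 'I_k) :
    diag_mx r ^+ N + \sum_(j < N) c j *: diag_mx r ^+ j = 0 ->
  r 0 i ^+ N + \sum_(j < N) c j * r 0 i ^+ j = 0.
Proof.
move=> /matrixP/(_ i i); rewrite !mxE diag_mx_exp summxE; apply: etrans.
by congr (_ + _); apply: eq_bigr => j _; rewrite mxE diag_mx_exp.
Qed.

(** The other terms have degree below N, so the coefficient of degree N of the
    left-hand side is 1. *)
Lemma polyX_not_integral (R : nzRingType) (N : nat) (a : 'I_N -> R) :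
  'X^N + \sum_(j < N) (a j)%:P * 'X^j != 0 :> {poly R}.
Proof.
apply/eqP => /(congr1 (coefp N)) /=.
rewrite coefD coefXn eqxx coef_sum big1 => [|j _]; last first.
  by rewrite coefCM coefXn gtn_eqF ?mulr0.
by rewrite addr0 coef0 => /eqP; rewrite oner_eq0.
Qed.

Section Specialize.

Variables (F : fieldType) (k : nat) (d : 'I_k -> F) (I : {set 'I_k}).

Definition specialize : {mpoly F[k]} -> {poly F} :=
  mmap (@polyC F) (fun i => if i \in I then 'X else 0).

HB.instance Definition _ := GRing.RMorphism.on specialize.

Lemma specializeX i : specialize 'X_i = if i \in I then 'X else 0.
Proof. by rewrite /specialize mmapX mmap1U. Qed.

Lemma specializeZ a f : specialize (a *: f) = a%:P * specialize f.
Proof. exact: mmapZ. Qed.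

(** Positivity of n matters: the exponent 0 would also count the variables
    outside I, since 0 ^+ 0 = 1. *)
Lemma specialize_weighted_psum n : (1 <= n)%N ->
  specialize (weighted_psum d n) = (\sum_(i in I) d i)%:P * 'X^n.
Proof.
move=> n_gt0; rewrite rmorph_sum rmorph_sum mulr_suml [RHS]big_mkcond.
apply: eq_bigr => i _; rewrite /= specializeZ rmorphXn /= specializeX.
by case: ifP => _ //; rewrite expr0n gtn_eqF // mulr0.
Qed.

(** Constants form a subalgebra of {poly F}, so it suffices to look at the
    generators, and these vanish because the weights over I cancel. *)
Lemma specialize_psum_algebra f : \sum_(i in I) d i = 0 ->
  psum_algebra d f -> exists a : F, specialize f = a%:P.
Proof.
move=> dI0; elim=> {f} [_ [n n_gt0 ->]||a u v _ [b bE] _ [c cE]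
                        |u v _ [b bE] _ [c cE]].
- by exists 0; rewrite specialize_weighted_psum // dI0 mul0r.
- by exists 1; rewrite rmorph1.
- by exists (a * b + c); rewrite rmorphD /= specializeZ bE cE polyCD polyCM.
- by exists (b * c); rewrite rmorphM /= bE cE polyCM.
Qed.

End Specialize.

Theorem theorem2p1 (F : fieldType) (k : nat) (hk : (1 <= k)%N)
    (d : 'I_k -> F) (hd : forall i, d i != 0)
    (hI : exists2 I : {set 'I_k}, I != set0 & \sum_(i in I) d i = 0) :
  ~ mx_integral_over (psum_algebra d) (diag_vars F k).
Proof.
case: hI => I /set0Pn [i iI] dI0 [N [c [_ cL eqX]]].
have [a aE] : exists a : {ffun 'I_N -> F},
    forall j, specialize F k I (c j) = (a j)%:P.
  (* Reading off the coefficient of degree 0 chooses all the constants at once. *)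
  exists [ffun j => (specialize F k I (c j))`_0] => j; rewrite ffunE.
  by have [b ->] := specialize_psum_algebra F k d I (c j) dI0 (cL j);
     rewrite coefC.
have := polyX_not_integral _ _ a; apply/negP/negPn/eqP.
have := diag_mx_integral_entry _ _ _ _ _ i eqX.
move=> /(congr1 (specialize F k I)).
rewrite rmorph0 rmorphD rmorphXn rmorph_sum /= mxE specializeX iI.
apply: etrans; congr (_ + _); apply: eq_bigr => j _.
by rewrite rmorphM rmorphXn /= specializeX iI aE.
Qed.
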